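(* Fix $\vartheta>0$. Then there is an open set $\mathcal{D}_1\subset\mathbb{C}$ with $\mathbb{R}\subset\mathcal{D}_1$ such that $$ \lim_{n\to\infty}\frac{\mathbb{E}\, e^{zX^{(1)}_{n,\vartheta n}}}{e^{n\varphi_1(z;\vartheta)}}=e^{z/2}\sqrt{\frac{\vartheta+1}{\vartheta e^z+1}},\qquad z\in\mathcal{D}_1, $$ where $\varphi_1(z;\vartheta):=L_1(\vartheta e^z)-L_1(\vartheta)$. Moreover, the convergence is locally uniform on $\mathcal{D}_1$ with speed $O(1/n)$, i.e. for every compact $K\subset\mathcal{D}_1$ the supremum over $z\in K$ of the absolute difference of the two sides is $O(1/n)$ as $n\to\infty$.
   Context: Let $\genfrac{[}{]}{0pt}{}{n}{k}$ be the (unsigned) Stirling numbers of the first kind and $S_n(x)=x(x+1)\cdots(x+n-1)=\sum_{k=1}^n\genfrac{[}{]}{0pt}{}{n}{k}x^k$. For $n\in\mathbb{N}$, $\theta>0$, the random variable $X^{(1)}_{n,\theta}$ has distribution $\mathbb{P}[X^{(1)}_{n,\theta}=k]=\genfrac{[}{]}{0pt}{}{n}{k}\theta^k/S_n(\theta)$, $k\in\{1,\dots,n\}$; thus $\mathbb{E}e^{zX^{(1)}_{n,\theta}}=S_n(\theta e^z)/S_n(\theta)$ for $z\in\mathbb{C}$. Define $L_1(z):=(z+1)\log(z+1)-z\log z$ for $z\in\mathbb{C}\setminus(-\infty,0]$. Logarithms and square roots are principal branches (the set $\mathcal{D}_1$ being such that all expressions are defined on it). *)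

(* Defs.v *)
From HB Require Import structures.
From mathcomp Require Import all_boot all_order all_algebra.
From mathcomp Require Import all_classical all_reals all_analysis.
From mathcomp Require Import complex.

Set Implicit Arguments.
Unset Strict Implicit.
Unset Printing Implicit Defensive.

Import Order.TTheory GRing.Theory Num.Theory.
Import numFieldNormedType.Exports.

Local Open Scope classical_set_scope.
Local Open Scope ring_scope.
Local Open Scope complex_scope.

(* Unsigned Stirling numbers of the first kind. *)
Fixpoint stirling1 (n k : nat) : nat :=
  match n, k with
  | 0, 0 => 1
  | 0, _.+1 => 0
  | n'.+1, 0 => n' * stirling1 n' 0
  | n'.+1, k'.+1 => n' * stirling1 n' k + stirling1 n' k'
  end%N.

(* S_n(x) = x (x + 1) ... (x + n - 1). *)
Definition rising (A : pzSemiRingType) (n : nat) (x : A) : A :=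
  \prod_(i < n) (x + i%:R).

Lemma stirling1_gt (n k : nat) : (n < k)%N -> stirling1 n k = 0%N.
Proof.
elim: n k => [|n IHn] [|k] //= ltnk.
by rewrite !IHn ?muln0// ltnW.
Qed.

Lemma stirling1_0 (n : nat) : (0 < n)%N -> stirling1 n 0 = 0%N.
Proof.
by elim: n => // -[//|n] IHn _; rewrite /= -/(stirling1 n.+1 0) IHn ?muln0.
Qed.

Lemma risingE (A : comPzSemiRingType) (n : nat) (x : A) :
  rising n x = \sum_(k < n.+1) (stirling1 n k)%:R * x ^+ k.
Proof.
elim: n => [|n IHn].
  by rewrite /rising big_ord0 big_ord_recl big_ord0 addr0 mul1r expr0.
rewrite /rising big_ord_recr/= -/(rising n x) IHn mulrDr big_distrl/=.
rewrite [RHS]big_ord_recl/=.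
under [in RHS]eq_bigr => i _ do rewrite /bump/= add1n natrD mulrDl.
rewrite big_split/= addrA; rewrite [RHS]addrC; congr (_ + _).
  by apply: eq_bigr => i _; rewrite -mulrA -exprSr.
have := @big_ord_recl A 0 +%R n.+1
  (fun i : 'I_n.+2 => (n * stirling1 n i)%:R * x ^+ i).
move=> E; apply: etrans E; rewrite [RHS]big_ord_recr/= (stirling1_gt (ltnSn n)).
rewrite muln0 mul0r addr0 big_distrl/=; apply: eq_bigr => i _.
by rewrite natrM mulrC mulrA.
Qed.

Section complex_functions.
Context {R : realType}.
Implicit Types z : R[i].

Definition cexp z : R[i] :=
  let: x +i* y := z in (expR x * cos y) +i* (expR x * sin y).

(* C \ (-oo, 0] *)
Definition slit_plane : set R[i] :=
  [set z | ~ (complex.Re z <= 0 /\ complex.Im z = 0)].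

(* The principal argument, with values in (-pi, pi]. *)
Definition carg z : R :=
  let t := acos (complex.Re z / Normc.normc z) in
  if 0 <= complex.Im z then t else - t.

Definition clog z : R[i] := ln (Normc.normc z) +i* carg z.

Definition L1 z : R[i] := (z + 1) * clog (z + 1) - z * clog z.

Definition phi1 (theta : R) z : R[i] :=
  L1 (theta%:C * cexp z) - L1 theta%:C.

(* [sqrtc] is the principal square root; the generic [sqrtC] of
   numClosedFieldType, whose values have nonnegative imaginary part, is not. *)
Definition limit1 (theta : R) z : R[i] :=
  cexp (z / 2) * sqrtc ((theta%:C + 1) / (theta%:C * cexp z + 1)).

End complex_functions.

Section random_variables.
Context {d : measure_display} {T : measurableType d} {R : realType}.
Variable P : probability T R.

(* Expectation of a complex random variable with integrable real and imaginary
   parts; [fine] makes it a junk value otherwise. *)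
Definition cexpectation (Y : T -> R[i]) : R[i] :=
  fine ('E_P[fun t => complex.Re (Y t)])%E +i*
  fine ('E_P[fun t => complex.Im (Y t)])%E.

Definition mgf_C (X : {RV P >-> R}) (z : R[i]) : R[i] :=
  cexpectation (fun t => cexp (z * (X t)%:C)).

(* The law of X^(1)_{n,theta}.  These n masses sum to 1 when 0 < n, so nothing
   needs to be said outside of {1, ..., n}. *)
Definition has_stirling_law (n : nat) (theta : R) (X : {RV P >-> R}) : Prop :=
  forall k : nat, (1 <= k <= n)%N ->
    pmf X k%:R = (stirling1 n k)%:R * theta ^+ k / rising n theta.

End random_variables.

(* Main.v *)
(* With w = theta e^z and D the strip |Im z| < pi/2, where Re w > 0, the ratio of
   moment generating function and exponential is A_n(w) / A_n(theta) for
     A_n(w) = exp (sum_(i < n) log (w + i/n) - n (L1 w - 1)).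
   The sum is a Riemann sum of t |-> log (w + t), whose primitive is
   a |-> a log a - a, and L1 w - 1 is the integral over [0, 1].  The trapezoidal
   rule gives sum - n (L1 w - 1) = - (log (w + 1) - log w) / 2 + O(1/n), with a
   constant depending only on a lower bound of Re w, and exponentiating the
   boundary terms yields e^(z/2) sqrt ((theta + 1) / (w + 1)).  Complex analysis
   is avoided: the second order expansion of log (a + t) is obtained by the mean
   value theorem in the real variable t, on real and imaginary parts. *)
Require Import Defs.
From HB Require Import structures.
From mathcomp Require Import all_boot all_order all_algebra.
From mathcomp Require Import all_classical all_reals all_analysis.
From mathcomp Require Import measurable_realfun complex.
From mathcomp Require Import ring lra.
Set Implicit Arguments.
Unset Strict Implicit.

Import Order.TTheory GRing.Theory Num.Theory.
Import numFieldNormedType.Exports.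
Local Open Scope classical_set_scope.
Local Open Scope ring_scope.
Local Open Scope complex_scope.
Import Normc.


(** * Complex exponential, principal logarithm and square root on the right half-plane *)

Section complex_exp_log.
Context {R : realType}.
Implicit Types (a b z w : R[i]) (x y r : R).

Lemma norm_normc z : `|z| = (normc z)%:C. Proof. by []. Qed.

Lemma normc_ge0 z : 0 <= normc z.
Proof. by case: z => x y; exact: sqrtr_ge0. Qed.

Lemma sqr_normcE z : normc z ^+ 2 = complex.Re z ^+ 2 + complex.Im z ^+ 2.
Proof. by case: z => x y /=; rewrite sqr_sqrtr// addr_ge0// sqr_ge0. Qed.

Lemma ge_normc_Re z : `|complex.Re z| <= normc z.
Proof.
rewrite -ler_sqr ?nnegrE ?normr_ge0 ?normc_ge0// real_normK ?num_real//.
by rewrite sqr_normcE lerDl sqr_ge0.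
Qed.

Lemma ge_normc_Im z : `|complex.Im z| <= normc z.
Proof.
rewrite -ler_sqr ?nnegrE ?normr_ge0 ?normc_ge0// real_normK ?num_real//.
by rewrite sqr_normcE lerDr sqr_ge0.
Qed.

Lemma normc_le_ReIm z : normc z <= `|complex.Re z| + `|complex.Im z|.
Proof.
rewrite -ler_sqr ?nnegrE ?addr_ge0 ?normr_ge0 ?normc_ge0// sqr_normcE.
rewrite sqrrD !real_normK ?num_real// -addrA lerD2l lerDr.
by rewrite mulrn_wge0// mulr_ge0.
Qed.

Lemma normc_real x : normc x%:C = `|x|.
Proof. by rewrite /= expr0n/= addr0 sqrtr_sqr. Qed.

Lemma normc_nat n : normc (n%:R : R[i]) = n%:R.
Proof. by rewrite -(rmorph_nat (real_complex R)) normc_real normr_nat. Qed.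

Lemma Re_gt0_normc_gt0 z : 0 < complex.Re z -> 0 < normc z.
Proof.
by move=> z0; rewrite (lt_le_trans z0)// (le_trans (ler_norm _))// ge_normc_Re.
Qed.

Lemma Re_gt0_neq0 z : 0 < complex.Re z -> z != 0.
Proof. by apply: contraTneq => ->; rewrite ltxx. Qed.

Lemma Re_realM r z : complex.Re (r%:C * z) = r * complex.Re z.
Proof. by case: z => x y /=; rewrite mul0r subr0. Qed.

Lemma Im_realM r z : complex.Im (r%:C * z) = r * complex.Im z.
Proof. by case: z => x y /=; rewrite mul0r addr0. Qed.

Lemma ReD a b : complex.Re (a + b) = complex.Re a + complex.Re b.
Proof. by case: a b => [x y] []. Qed.

Lemma ImD a b : complex.Im (a + b) = complex.Im a + complex.Im b.
Proof. by case: a b => [x y] []. Qed.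

Lemma ReN a : complex.Re (- a) = - complex.Re a.
Proof. by case: a. Qed.

Lemma ImN a : complex.Im (- a) = - complex.Im a.
Proof. by case: a. Qed.

Lemma cexpD a b : cexp (a + b) = cexp a * cexp b.
Proof.
case: a b => [x y] [x' y'] /=; rewrite expRD cosD sinD.
by apply/eqP; rewrite eq_complex /=; apply/andP; split; apply/eqP; ring.
Qed.

Lemma cexp0 : cexp (0 : R[i]) = 1.
Proof. by rewrite /cexp/= expR0 cos0 sin0 mulr0 mulr1. Qed.

Lemma normc_cexp z : normc (cexp z) = expR (complex.Re z).
Proof.
case: z => x y /=; rewrite !exprMn -mulrDr cos2Dsin2 mulr1.
by rewrite sqrtr_sqr ger0_norm// expR_ge0.
Qed.

Lemma cexp_neq0 z : cexp z != 0.
Proof.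
apply/eqP => z0; have := normc_cexp z; rewrite z0 normc0.
by move/eqP; rewrite lt_eqF// expR_gt0.
Qed.

Lemma cexpN z : cexp (- z) = (cexp z)^-1.
Proof.
by apply: (mulfI (cexp_neq0 z)); rewrite -cexpD subrr cexp0 divff// cexp_neq0.
Qed.

Lemma cexp_sum (I : Type) (s : seq I) (F : I -> R[i]) :
  cexp (\sum_(i <- s) F i) = \prod_(i <- s) cexp (F i).
Proof. exact: (big_morph _ cexpD cexp0). Qed.

Lemma cexpMn z n : cexp (z *+ n) = cexp z ^+ n.
Proof.
by elim: n => [|n IHn]; rewrite ?mulr0n ?expr0 ?cexp0// mulrS cexpD IHn exprS.
Qed.

Lemma cos_atan_div z : 0 < complex.Re z ->
  cos (atan (complex.Im z / complex.Re z)) = complex.Re z / normc z.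
Proof.
move=> z0; set t := complex.Im z / complex.Re z.
have n0 := Re_gt0_normc_gt0 z0.
rewrite cos_atan -[RHS]invrK invf_div; congr (_^-1).
apply: (@pexpIrn _ 2) => //; rewrite ?nnegrE ?sqrtr_ge0 ?divr_ge0 ?ltW//.
rewrite sqr_sqrtr ?addr_ge0 ?sqr_ge0// /t !expr_div_n sqr_normcE.
by rewrite mulrDl divff// sqrf_eq0 gt_eqF.
Qed.

(** On the right half-plane the arccosine in [carg] becomes an arctangent. Unlike the case
    distinction on the sign of the imaginary part, this form can be differentiated directly. *)
Lemma clogE z : 0 < complex.Re z ->
  clog z = ln (normc z) +i* atan (complex.Im z / complex.Re z).
Proof.
move=> z0; rewrite /clog; congr (_ +i* _); rewrite /carg.
set t := complex.Im z / complex.Re z.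
have n0 := Re_gt0_normc_gt0 z0.
rewrite -cos_atan_div// -/t.
have pi2 : pi / 2 <= pi :> R by have := pi_gt0 R; lra.
have at1 := atan_gtNpi2 t; have at2 := atan_ltpi2 t.
(* [acos] inverts [cos] only on [0, pi]; below the real axis the arctangent is not positive, and
   evenness of [cos] accounts for the sign flip in [carg]. *)
case: ifPn => [y0|].
  rewrite cosK// in_itv/= (le_trans (ltW at2))// andbT -atan0 le_atan//.
  by rewrite divr_ge0// ltW.
rewrite -ltNge => y0; rewrite cosKN ?opprK// -(@atan0 R) le_atan ?andbT.
  by move: at1; lra.
by rewrite pmulr_lle0 ?invr_gt0// ltW.
Qed.

Lemma clogK z : 0 < complex.Re z -> cexp (clog z) = z.
Proof.
move=> z0; rewrite clogE//= lnK ?posrE ?Re_gt0_normc_gt0//.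
have c0 : cos (atan (complex.Im z / complex.Re z)) != 0.
  rewrite cos_atan invr_neq0// gt_eqF// sqrtr_gt0.
  by rewrite (lt_le_trans ltr01)// lerDl sqr_ge0.
set t := _ / _; have -> : sin (atan t) = t * cos (atan t).
  by rewrite -{2}(atanK t) /tan divfK.
rewrite cos_atan_div//.
have n0 : normc z != 0 by rewrite gt_eqF// Re_gt0_normc_gt0.
have r0 : complex.Re z != 0 by rewrite gt_eqF.
rewrite /t; move: n0 r0; set N := normc z; case: (z) => x y /= n0 x0.
by congr (_ +i* _); field; rewrite ?n0.
Qed.

Lemma cos_gt0_pi2 y : `|y| < pi / 2 -> 0 < cos y.
Proof. by move=> yp; apply: cos_gt0_pihalf; rewrite -ltr_norml. Qed.

Lemma Re_cexp_gt0 r z : 0 < r -> `|complex.Im z| < pi / 2 ->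
  0 < complex.Re (r%:C * cexp z).
Proof.
move=> r0 zp; rewrite Re_realM mulr_gt0//; case: z zp => x y /= yp.
by rewrite mulr_gt0 ?expR_gt0 ?cos_gt0_pi2.
Qed.

(** The quotient of imaginary and real part is tan (Im z), and [atan] returns Im z itself because
    |Im z| < pi/2. *)
Lemma cexpK r z : 0 < r -> `|complex.Im z| < pi / 2 ->
  clog (r%:C * cexp z) = (ln r)%:C + z.
Proof.
move=> r0 zp; rewrite clogE ?Re_cexp_gt0// Re_realM Im_realM.
rewrite normcM normc_cexp normc_real (gtr0_norm r0) lnM ?posrE ?expR_gt0// expRK.
case: z zp => x y /= yp; apply/eqP; rewrite eq_complex/= add0r eqxx/=; apply/eqP.
rewrite -mulf_div divff ?gt_eqF// mul1r -mulf_div divff ?gt_eqF ?expR_gt0// mul1r.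
by rewrite -/(tan y) tanK// in_itv/= -ltr_norml.
Qed.

Lemma clog_real r : 0 < r -> clog r%:C = (ln r)%:C.
Proof.
move=> r0; have := @cexpK r 0 r0; rewrite cexp0 mulr1 addr0; apply.
by rewrite normr0 divr_gt0 ?pi_gt0.
Qed.

(** Both sides have the same square, so they agree up to sign. The sign is decided by real parts:
    that of [sqrtc] is nonnegative, and that of e^(z/2) is positive since |Im z / 2| < pi/2. *)
Lemma sqrtc_cexp z : `|complex.Im z| < pi -> sqrtc (cexp z) = cexp (z / 2).
Proof.
move=> zp; have: sqrtc (cexp z) ^+ 2 = cexp (z / 2) ^+ 2.
  by rewrite sqr_sqrtc -cexpMn -[_ / 2 *+ 2]mulr_natr divfK// pnatr_eq0.
move/eqP; rewrite eqf_sqr => /orP[/eqP//|/eqP e].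
have: 0 <= complex.Re (sqrtc (cexp z)).
  by case: (cexp z) => x y /=; exact: sqrtr_ge0.
have : 0 < complex.Re (cexp (z / 2)).
  have -> : z / 2 = (2^-1)%:C * z.
    by rewrite mulrC (fmorphV (real_complex R)) rmorph_nat.
  rewrite /cexp; case: (z) zp => x y /= yp; rewrite !mul0r subr0 addr0.
  rewrite mulr_gt0 ?expR_gt0// cos_gt0_pi2// normrM ger0_norm ?invr_ge0//.
  by move: yp; lra.
by rewrite e ReN oppr_ge0 => /lt_geF ->.
Qed.

End complex_exp_log.

(** * Expansions of logarithm and exponential along real parameters *)

Section complex_taylor.
Context {R : realType}.
Implicit Types (a z w : R[i]) (x y r t h : R).

Lemma MVT_norm_le (f df : R -> R) h M : 0 <= h ->
  (forall t, 0 <= t <= h -> is_derive t 1 f (df t)) ->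
  (forall t, 0 <= t <= h -> `|df t| <= M) -> `|f h - f 0| <= M * h.
Proof.
move=> h0 fdf dfM.
have [t||c] := @MVT_segment _ f df 0 h h0.
- by rewrite in_itv/= => /andP[/ltW ? /ltW ?]; apply: fdf; apply/andP.
- apply: derivable_within_continuous => t; rewrite in_itv/= => /fdf dft.
  exact: (@ex_derive _ _ _ _ _ _ _ dft).
by rewrite in_itv/= => /dfM ? ->; rewrite subr0 normrM (ger0_norm h0) ler_wpM2r.
Qed.

(** The mean value theorem gives no common intermediate point for complex values, so it is applied
    to real and imaginary parts separately, at the cost of a factor 2. *)
Lemma normc_MVT_le (f df : R -> R[i]) h M : 0 <= h ->
  (forall t, 0 <= t <= h ->
    is_derive t 1 (fun t => complex.Re (f t)) (complex.Re (df t))) ->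
  (forall t, 0 <= t <= h ->
    is_derive t 1 (fun t => complex.Im (f t)) (complex.Im (df t))) ->
  (forall t, 0 <= t <= h -> normc (df t) <= M) ->
  normc (f h - f 0) <= 2 * M * h.
Proof.
move=> h0 dRe dIm dfM; apply: le_trans (normc_le_ReIm _) _.
rewrite ReD ImD ReN ImN -mulrA mulr_natl mulr2n.
by apply: lerD; [apply: (MVT_norm_le h0 dRe)|apply: (MVT_norm_le h0 dIm)] => t th;
  rewrite (le_trans _ (dfM t th))// ?ge_normc_Re ?ge_normc_Im.
Qed.

Lemma normcD_real a t : 0 < complex.Re a -> 0 <= t ->
  normc a <= normc (a + t%:C).
Proof.
move=> a0 t0; rewrite -ler_sqr ?nnegrE ?normc_ge0// !sqr_normcE.
have a0' := ltW a0.
by rewrite ReD ImD/= addr0 lerD2r ler_sqr ?nnegrE ?addr_ge0// lerDl.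
Qed.

(** The remainder, as a function of the increment t, has derivative 1/(a+t) - 1/a + t/a^2 =
    (t/a)^2/(a+t). Since |a+t| >= |a|, this is at most (h/|a|)^2/|a| on [0, h]. *)
Lemma clog_taylor a h : 0 < complex.Re a -> 0 <= h ->
  normc (clog (a + h%:C) - clog a - (h%:C / a - (h%:C / a) ^+ 2 / 2))
    <= 2 * (h / normc a) ^+ 3.
Proof.
move=> a0 h0.
have an0 : 0 < normc a by exact: Re_gt0_normc_gt0.
have ac0 : a != 0 by exact: Re_gt0_neq0.
have aDt t : 0 <= t -> 0 < complex.Re (a + t%:C).
  by move=> t0; rewrite ReD/= ltr_pwDl.
pose p := complex.Re a^-1; pose q := complex.Im a^-1.
pose p2 := complex.Re (a ^- 2); pose q2 := complex.Im (a ^- 2).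
pose x := complex.Re a; pose y := complex.Im a.
pose N t := (x + t) ^+ 2 + y ^+ 2.
(* Real and imaginary parts of log (a+t) - t/a + (t/a)^2/2 as explicit real functions of t, with ln
   |a+t| written as half of ln |a+t|^2 to avoid the square root. *)
pose f t : R[i] := (2^-1 * ln (N t) + (- p * t + p2 / 2 * (t * t))) +i*
                   (atan (y * (x + t)^-1) + (- q * t + q2 / 2 * (t * t))).
pose df t : R[i] := (t%:C / a) ^+ 2 / (a + t%:C).
have fE t : 0 <= t ->
    f t = clog (a + t%:C) - (t%:C / a - (t%:C / a) ^+ 2 / 2).
  move=> t0; rewrite clogE ?aDt//.
  have -> : ln (normc (a + t%:C)) = 2^-1 * ln (N t).
    have -> : N t = normc (a + t%:C) ^+ 2.
      by rewrite sqr_normcE ReD ImD/= addr0.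
    rewrite lnXn ?Re_gt0_normc_gt0 ?aDt//.
    by rewrite -[X in _ = _ * X]mulr_natl mulKf ?pnatr_eq0.
  rewrite ReD ImD/= addr0 opprB addrC.
  have -> : (t%:C / a) ^+ 2 / 2 - t%:C / a =
     (- p * t + p2 / 2 * (t * t)) +i* (- q * t + q2 / 2 * (t * t)).
    have -> : (t%:C / a) ^+ 2 / 2 - t%:C / a =
       (t * t / 2)%:C * a ^- 2 - t%:C * a^-1.
      rewrite rmorphM rmorphM (fmorphV (real_complex R)) rmorph_nat.
      by rewrite expr_div_n -expr2 -!mulrA [2^-1 * _]mulrC.
    rewrite /p /q /p2 /q2; case: (a^-1) (a ^- 2) => [p' q'] [p2' q2'] /=.
    by apply/eqP; rewrite eq_complex/=; apply/andP; split; apply/eqP; ring.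
  apply/eqP; rewrite eq_complex/= /f/=; apply/andP.
  by split; apply/eqP; rewrite /x /y; ring.
have xt0 t : 0 <= t -> 0 < x + t by move=> t0; rewrite ltr_pwDl.
have Nt0 t : 0 <= t -> 0 < N t.
  by move=> t0; rewrite ltr_pwDl ?sqr_ge0// exprn_gt0 ?xt0.
have dfE t : 0 <= t ->
   df t = (2^-1 * (2 * (x + t) / N t) + (- p + p2 * t)) +i*
          (- (y / N t) + (- q + q2 * t)).
  move=> t0.
  have -> : df t = (a + t%:C)^-1 - a^-1 + t%:C * a ^- 2.
    rewrite /df; have := Re_gt0_neq0 (aDt t t0) => at0.
    by field; rewrite ac0 at0.
  have -> : (a + t%:C)^-1 = ((x + t) / N t) +i* (- (y / N t)).
    rewrite /N /x /y; case: (a) => x' y' /=.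
    have -> : (x' +i* y') + t%:C = (x' + t) +i* y'.
      by apply/eqP; rewrite eq_complex/= addr0 !eqxx.
    by [].
  rewrite /p /q /p2 /q2; case: (a^-1) (a ^- 2) => [p' q'] [p2' q2'] /=.
  apply/eqP; rewrite eq_complex/=; apply/andP; split; apply/eqP; last by ring.
  rewrite -[2 * (x + t) / N t]mulrA mulKf ?pnatr_eq0//; ring.
have -> : clog (a + h%:C) - clog a - (h%:C / a - (h%:C / a) ^+ 2 / 2) = f h - f 0.
  rewrite !fE// !mul0r expr0n/= mul0r subr0 addr0 subr0.
  by rewrite addrAC.
have -> : 2 * (h / normc a) ^+ 3 = 2 * ((h / normc a) ^+ 2 / normc a) * h.
  by field; rewrite gt_eqF.
have dpoly (c e t : R) :
   is_derive t 1 (fun t : R => c * t + e / 2 * (t * t)) (c + e * t).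
  have d1 := is_deriveM (is_derive_cst c t 1) (is_derive_id t (1 : R)).
  have d2 := is_deriveM (is_derive_cst (e / 2) t 1)
     (is_deriveM (is_derive_id t (1 : R)) (is_derive_id t (1 : R))).
  apply: (is_derive_eq (is_deriveD d1 d2)).
  by rewrite /GRing.scale/= /cst/=; field.
have dxt t : is_derive t 1 (fun t : R => x + t) 1.
  have d1 := is_deriveD (is_derive_cst x t 1) (is_derive_id t (1 : R)).
  by apply: (is_derive_eq d1); rewrite add0r.
apply: (@normc_MVT_le f df h _ h0) => t /andP[t0 th].
- rewrite dfE//=.
  have dN : is_derive t 1 N (2 * (x + t)).
    have d1 := is_deriveD (is_deriveX 2 (dxt t)) (is_derive_cst (y ^+ 2) t 1).
    apply: (is_derive_eq d1).
    by rewrite /GRing.scale/= addr0 mulr1.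
  have dln := is_derive1_comp (is_derive1_ln (Nt0 t t0)) dN.
  have dln2 := is_deriveM (is_derive_cst (2^-1 : R) t 1) dln.
  apply: (is_derive_eq (is_deriveD dln2 (dpoly (- p) p2 t))).
  by rewrite /GRing.scale/= /cst/= mulr0 addr0 [_^-1 * (2 * _)]mulrC.
- rewrite dfE//=.
  have dV := is_deriveV (lt0r_neq0 (xt0 t t0)) (dxt t).
  have dyV := is_deriveM (is_derive_cst y t 1) dV.
  have dat := @is_derive1_comp _ atan (fun t => y * (x + t)^-1) t _ _
    (is_derive1_atan _) dyV.
  apply: (is_derive_eq (is_deriveD dat (dpoly (- q) q2 t))).
  congr (_ + _); rewrite /GRing.scale/= /cst/= mulr0 addr0 mulr1 /N.
  have := Nt0 t t0; have := xt0 t t0; rewrite /N => /lt0r_neq0 x0 /lt0r_neq0 n0.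
  field; rewrite x0 n0 /=.
  by [].
- rewrite /df normcM normcV.
  apply: ler_pM; rewrite ?normc_ge0 ?invr_ge0 ?normc_ge0//.
    rewrite expr2 normcM normcM normcV normc_real (ger0_norm t0).
    rewrite -expr2 ler_sqr ?nnegrE ?divr_ge0 ?normc_ge0 ?ler_pM2r ?invr_gt0//.
  by rewrite lef_pV2 ?posrE ?Re_gt0_normc_gt0 ?aDt// normcD_real.
Qed.

(** Mean value bound for t |-> e^(tz) on [0, 1], whose derivative z e^(tz) has modulus at most |z|
    e^B. This would give the constant 2; 4 leaves slack. *)
Lemma cexp_sub1 z B : normc z <= B -> normc (cexp z - 1) <= 4 * expR B * normc z.
Proof.
case: z => a b zB.
pose f t : R[i] := (expR (a * t) * cos (b * t)) +i* (expR (a * t) * sin (b * t)).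
pose df t : R[i] := (a +i* b) * f t.
have dl (c t : R) : is_derive t 1 (fun t : R => c * t) c.
  apply: (is_derive_eq (is_deriveM (is_derive_cst c t 1) (is_derive_id t (1 : R)))).
  by rewrite /GRing.scale/= /cst/= mulr1 mulr0 addr0.
have -> : cexp (a +i* b) - 1 = f 1 - f 0.
  by rewrite /f !mulr1 !mulr0 expR0 cos0 sin0 mulr0 mulr1.
apply: (@le_trans _ _ (2 * (normc (a +i* b) * expR B) * 1)); last first.
  rewrite mulr1 [normc _ * _]mulrC mulrA ler_wpM2r ?normc_ge0//.
  rewrite ler_wpM2r ?expR_ge0//.
  by rewrite ler_nat.
apply: (@normc_MVT_le f df 1) => // t /andP[t0 t1].
- have de := @is_derive1_comp _ (@expR R) (fun t => a * t) t _ _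
    (is_derive_expR _) (dl a t).
  have dc := @is_derive1_comp _ (@cos R) (fun t => b * t) t _ _
    (is_derive_cos _) (dl b t).
  apply: (is_derive_eq (is_deriveM de dc)).
  by rewrite /df /f /GRing.scale/=; ring.
- have de := @is_derive1_comp _ (@expR R) (fun t => a * t) t _ _
    (is_derive_expR _) (dl a t).
  have dc := @is_derive1_comp _ (@sin R) (fun t => b * t) t _ _
    (is_derive_sin _) (dl b t).
  apply: (is_derive_eq (is_deriveM de dc)).
  by rewrite /df /f /GRing.scale/=; ring.
- rewrite /df normcM ler_wpM2l ?normc_ge0//.
  have -> : f t = cexp ((a * t) +i* (b * t)) by [].
  rewrite normc_cexp ler_expR/= (le_trans _ zB)//.
  rewrite (le_trans _ (ge_normc_Re (a +i* b)))//=.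
  rewrite (le_trans (ler_norm _))// normrM (ger0_norm t0) ler_piMr//.
Qed.

End complex_taylor.

(** * Trapezoidal rule for the logarithm and asymptotics of rising factorials *)

Section trapezoid.
Context {R : realType}.
Implicit Types (a z w : R[i]) (h k theta : R).

(** The left side compares the endpoint average of log with its mean over [a, a+h]. With u = h/a and
    log (a+h) = log a + u - u^2/2 + r, the terms of order below two cancel and u^2/4 - r/u - r/2
    remains. *)
Lemma trapezoid_step a h k : 0 < complex.Re a -> (normc a)^-1 <= k ->
  0 < h <= 1 ->
  normc ((clog a + clog (a + h%:C)) / 2 -
         ((a + h%:C) * clog (a + h%:C) - a * clog a) / h%:C + 1)
    <= (3 + k) * k ^+ 2 * h ^+ 2.
Proof.
move=> a0 ak /andP[h0 h1].
set u := h%:C / a.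
set r := clog (a + h%:C) - clog a - (u - u ^+ 2 / 2).
have an0 := Re_gt0_normc_gt0 a0.
have ac0 := Re_gt0_neq0 a0.
have hc0 : h%:C != 0 :> R[i] by apply: Re_gt0_neq0.
have -> : (clog a + clog (a + h%:C)) / 2 -
         ((a + h%:C) * clog (a + h%:C) - a * clog a) / h%:C + 1 =
  u ^+ 2 / 4 - r / u - r / 2.
  have -> : clog (a + h%:C) = clog a + (u - u ^+ 2 / 2) + r by rewrite /r; ring.
  by rewrite /u; move: r => r; field; rewrite hc0 ac0.
pose v := h / normc a.
have v0 : 0 < v by rewrite divr_gt0.
have nu : normc u = v by rewrite normcM normcV normc_real gtr0_norm.
have nr : normc r <= 2 * v ^+ 3 by apply: clog_taylor => //; exact: ltW.
have nc n : normc (n%:R^-1 : R[i]) = n%:R^-1 by rewrite normcV normc_nat.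
have vhk : v <= h * k by rewrite /v ler_pM2l.
have k0 : 0 < k by rewrite (lt_le_trans _ ak)// invr_gt0.
(* The three terms contribute v^2/4, 2 v^2 and v^3, where v = |u|; 1/4 + 2 is rounded up to 3. *)
apply: (@le_trans _ _ (3 * v ^+ 2 + v ^+ 3)).
  apply: le_trans (le_normcD _ _) _; rewrite normcN.
  have e1 : normc (u ^+ 2 / 4) = v ^+ 2 / 4.
    by rewrite normcM nc [u ^+ 2]expr2 (normcM u u) nu.
  have e2 : normc (r / u) <= 2 * v ^+ 2.
    rewrite normcM normcV nu ler_pdivrMr//.
    by rewrite (le_trans nr)// -mulrA -exprSr.
  have e3 : normc (r / 2) <= v ^+ 3 by rewrite normcM nc ler_pdivrMr// mulrC.
  have := le_normcD (u ^+ 2 / 4) (- (r / u)); rewrite normcN e1 => e4.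
  by have := sqr_ge0 v; lra.
have hk0 : 0 < h * k by rewrite mulr_gt0.
have e5 : v ^+ 2 <= (h * k) ^+ 2 by rewrite ler_sqr// nnegrE ltW.
(* One of the three factors v is bounded by k alone, using h <= 1. *)
have e6 : v ^+ 3 <= (h * k) ^+ 2 * k.
  rewrite exprSr; apply: ler_pM e5 _; rewrite ?sqr_ge0 ?(ltW v0)//.
  by rewrite (le_trans vhk)// ler_piMl// ltW.
rewrite (le_trans (lerD (ler_wpM2l _ e5) e6))//.
by rewrite le_eqVlt; apply/orP; left; apply/eqP; ring.
Qed.

(** What is left of the Riemann sum after its integral and the boundary correction. The correction
    appears because the sum takes left endpoints only. *)
Definition log_sum_error n w : R[i] :=
  \sum_(i < n) clog (w + (i%:R / n%:R)%:C) -
  (n%:R * (L1 w - 1) - (clog (w + 1) - clog w) / 2).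

(** The error is the sum of n trapezoidal steps of width h = 1/n, each O(h^2). All nodes lie to the
    right of w, so a single k serves every step. *)
Lemma log_sum_errorP n w k : (0 < n)%N -> 0 < complex.Re w ->
  (complex.Re w)^-1 <= k ->
  normc (log_sum_error n w) <= (3 + k) * k ^+ 2 / n%:R.
Proof.
move=> n0 w0 wk.
have nR0 : 0 < n%:R :> R by rewrite ltr0n.
have nC0 : n%:R != 0 :> R[i] by rewrite pnatr_eq0 -lt0n.
pose a i : R[i] := w + (i%:R / n%:R)%:C.
pose h : R := n%:R^-1.
have hC : h%:C = n%:R^-1 by rewrite /h (fmorphV (real_complex R)) rmorph_nat.
have aS i : a i.+1 = a i + h%:C.
  by rewrite /a -addrA -rmorphD -natr1 mulrDl mul1r.
have a_ge i : complex.Re w <= complex.Re (a i).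
  by rewrite ReD/= lerDl divr_ge0.
pose E i := (clog (a i) + clog (a i.+1)) / 2 -
            (a i.+1 * clog (a i.+1) - a i * clog (a i)) * n%:R + 1.
have -> : log_sum_error n w = \sum_(0 <= i < n) E i.
  (* Each endpoint average is the left value plus half an increment; the increments, and those of a
     log a, telescope. *)
  have -> : \sum_(0 <= i < n) E i =
    \sum_(0 <= i < n) (clog (a i) + (clog (a i.+1) - clog (a i)) / 2 -
            (a i.+1 * clog (a i.+1) - a i * clog (a i)) * n%:R + 1).
    by apply: eq_bigr => i _; rewrite /E; field.
  rewrite !big_split/= sumrN -!mulr_suml !telescope_sumr//.
  rewrite sumr_const_nat subn0 /log_sum_error.
  rewrite -(big_mkord predT (fun i => clog (a i))).
  have -> : a n = w + 1 by rewrite /a divff// gt_eqF.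
  have -> : a 0%N = w by rewrite /a mul0r addr0.
  by rewrite /L1; ring.
apply: (@le_trans _ _ (\sum_(0 <= i < n) (3 + k) * k ^+ 2 * h ^+ 2)); last first.
  rewrite sumr_const_nat subn0 -[leLHS]mulr_natr [h ^+ 2]expr2.
  rewrite -!mulrA mulVf ?mulr1//.
  by rewrite gt_eqF.
elim/big_ind2: _ => [||i _]; first by rewrite normc0.
  by move=> ? ? ? ? ? ?; rewrite (le_trans (le_normcD _ _))// lerD.
have ai0 := lt_le_trans w0 (a_ge i).
have := @trapezoid_step (a i) h k ai0.
rewrite /E aS hC invrK; apply.
  rewrite (le_trans _ wk)// lef_pV2 ?posrE ?Re_gt0_normc_gt0//.
  by rewrite (le_trans (a_ge i))// (le_trans (ler_norm _))// ge_normc_Re.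
by rewrite /h invr_gt0 nR0 invf_le1// ler1n.
Qed.

(** Each factor nw + i equals n exp (log (w + i/n)), as w + i/n stays in the right half-plane. The
    identity is exact, the error term being kept. *)
Lemma rising_cexp n w : (0 < n)%N -> 0 < complex.Re w ->
  rising n (n%:R * w) = n%:R ^+ n *
    cexp (n%:R * (L1 w - 1) - (clog (w + 1) - clog w) / 2 + log_sum_error n w).
Proof.
move=> n0 w0; rewrite /log_sum_error subrKC cexp_sum /rising.
rewrite -[X in _ ^+ X](card_ord n) -prodr_const -big_split.
apply: eq_bigr => i _.
have nC0 : n%:R != 0 :> R[i] by rewrite pnatr_eq0 -lt0n.
rewrite clogK; last by rewrite ReD/= ltr_wpDr ?divr_ge0.
rewrite /= mulrDr; congr (_ + _).
rewrite rmorphM (fmorphV (real_complex R)) !rmorph_nat.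
by rewrite mulrCA divff// mulr1.
Qed.

(** * The limit function and the ratio of rising factorials *)

Section limit.
Variables (theta : R) (z : R[i]).
Hypotheses (theta0 : 0 < theta) (zpi : `|complex.Im z| < pi / 2).
Let w := theta%:C * cexp z.

Let w0 : 0 < complex.Re w. Proof. exact: Re_cexp_gt0. Qed.

Let w1 : 0 < complex.Re (w + 1). Proof. by rewrite ReD/= addr_gt0. Qed.

Let t1 : 0 < theta + 1. Proof. by rewrite addr_gt0. Qed.

(** Difference of the trapezoidal boundary terms at w and at [theta]. *)
Let limit1_log : R[i] :=
  (clog w - clog theta%:C) / 2 + (clog (theta%:C + 1) - clog (w + 1)) / 2.

(** log w - log theta = z yields e^(z/2). The logarithm difference for (theta+1)/(w+1) has imaginary
    part of modulus below pi/2, so half of it gives the principal root. *)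
Lemma limit1E : limit1 theta z = cexp limit1_log.
Proof.
rewrite /limit1 /limit1_log -/w cexpD; congr (_ * _).
  by rewrite /w cexpK// clog_real// addrC addKr.
have tC : theta%:C + 1 = (theta + 1)%:C :> R[i] by rewrite rmorphD rmorph1.
rewrite -sqrtc_cexp.
  rewrite cexpD cexpN clogK; last by rewrite tC.
  by rewrite clogK.
rewrite tC clog_real// clogE// ImD ImN/= add0r normrN.
have := pi_gt0 R; have := atan_gtNpi2 (complex.Im (w + 1) / complex.Re (w + 1)).
have := atan_ltpi2 (complex.Im (w + 1) / complex.Re (w + 1)).
by rewrite ltr_norml => ? ? ?; apply/andP; split; lra.
Qed.

(** Re log (w+1) = ln |w+1| is nonnegative and may be dropped. The bound depends on z only through
    Re z, so boundedness on compact sets follows without continuity of [limit1]. *)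
Lemma normc_limit1_le :
  normc (limit1 theta z) <= expR ((complex.Re z + ln (theta + 1)) / 2).
Proof.
rewrite limit1E normc_cexp ler_expR /limit1_log -mulrDl.
have -> (v : R[i]) : complex.Re (v / 2) = complex.Re v / 2.
  rewrite mulrC -(rmorph_nat (real_complex R)).
  by rewrite -(fmorphV (real_complex R)) Re_realM mulrC.
rewrite ler_pM2r//.
have -> : clog w - clog theta%:C = z by rewrite /w cexpK// clog_real// addrC addKr.
have tC : theta%:C + 1 = (theta + 1)%:C :> R[i] by rewrite rmorphD rmorph1.
rewrite tC clog_real// (clogE w1) ReD lerD2l ReD ReN/= lerBlDr lerDl ln_ge0//.
rewrite (le_trans _ (ge_normc_Re _))// (le_trans _ (ler_norm _))//.
by rewrite ReD/= lerDr ltW.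
Qed.

(** The powers n^n and the constants -1 beside [L1] cancel, and the exponents linear in n are
    absorbed by [phi1]. *)
Lemma rising_ratio n : (0 < n)%N ->
  rising n (n%:R * w) / rising n (n%:R * theta%:C) / cexp (n%:R * phi1 theta z)
  = limit1 theta z * cexp (log_sum_error n w - log_sum_error n theta%:C).
Proof.
move=> n0; have nC0 : n%:R ^+ n != 0 :> R[i] by rewrite expf_neq0// pnatr_eq0 -lt0n.
rewrite !rising_cexp// -mulf_div divff// mul1r -!cexpN -!cexpD limit1E -cexpD.
by congr cexp; rewrite /phi1 /limit1_log -/w; field.
Qed.

Lemma rising_ratio_le n k : (0 < n)%N -> (complex.Re w)^-1 <= k -> theta^-1 <= k ->
  normc (rising n (n%:R * w) / rising n (n%:R * theta%:C) /
         cexp (n%:R * phi1 theta z) - limit1 theta z)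
  <= normc (limit1 theta z) * (4 * expR (2 * ((3 + k) * k ^+ 2)) *
       (2 * ((3 + k) * k ^+ 2))) / n%:R.
Proof.
move=> n0 wk tk; rewrite rising_ratio// -{2}[limit1 _ _]mulr1 -mulrBr normcM.
rewrite -[leRHS]mulrA ler_wpM2l ?normc_ge0//.
set C := (3 + k) * k ^+ 2.
set e := log_sum_error _ _ - _.
have k0 : 0 < k by rewrite (lt_le_trans _ tk)// invr_gt0.
have C0 : 0 <= C by rewrite mulr_ge0 ?sqr_ge0// addr_ge0// ltW.
have en : normc e <= 2 * C / n%:R.
  rewrite (le_trans (le_normcD _ _))// normcN -mulrA mulr_natl mulr2n.
  by rewrite lerD ?log_sum_errorP.
(* A bound free of n, so that the exponential constant from [cexp_sub1] is free of n; the finer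
   bound 2C/n supplies the rate. *)
have eB : normc e <= 2 * C.
  rewrite (le_trans en)// ler_piMr//; first exact: mulr_ge0.
  by rewrite invf_le1 ?ltr0n// ler1n.
apply: le_trans (cexp_sub1 eB) _.
by rewrite -[leRHS]mulrA ler_wpM2l// mulr_ge0// expR_ge0.
Qed.

End limit.
End trapezoid.

(** * Moment generating function of the Stirling law *)

Lemma rising_rmorph (A B : comPzRingType) (g : {rmorphism A -> B}) n a :
  g (rising n a) = rising n (g a).
Proof.
by rewrite rmorph_prod; apply: eq_bigr => i _; rewrite rmorphD rmorph_nat.
Qed.

Lemma risingE_pos (A : comPzSemiRingType) n (a : A) : (0 < n)%N ->
  rising n a = \sum_(1 <= k < n.+1) (stirling1 n k)%:R * a ^+ k.
Proof.
move=> n0; rewrite risingE -(big_mkord predT (fun k => (stirling1 n k)%:R * a ^+ k)).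
by rewrite big_nat_recl// stirling1_0// mul0r add0r big_add1.
Qed.

Section stirling_mgf.
Context {d : measure_display} {T : measurableType d} {R : realType}.
Variable P : probability T R.
Implicit Types (X : {RV P >-> R}) (s : seq R) (f : R -> R).

Let Lfun1_indic (A : set T) : measurable A -> (\1_A : T -> R) \in Lfun P 1.
Proof. by move=> mA; apply/Lfun1_integrable; exact: integrable_indic. Qed.

(** A simple function that agrees with f o X where X takes values in s, and whose expectation
    follows by linearity. *)
Let atoms X s f : T -> R :=
  \sum_(r <- s) f r \o* (\1_(X @^-1` [set r]) : T -> R).

Let expectation_atoms X s f :
  'E_P[atoms X s f]%E = (\sum_(r <- s) f r * pmf X r)%:E.
Proof.
rewrite /atoms.
rewrite -(big_map (fun r => f r \o* (\1_(X @^-1` [set r]) : T -> R)) predT id).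
rewrite expectation_sum.
  rewrite big_map -sumEFin; apply: eq_bigr => r _.
  rewrite expectationZl ?Lfun1_indic// expectation_indic// EFinM /pmf fineK//.
  exact: fin_num_measure.
move=> _ /mapP[r _ ->].
by apply: Lfun_scale => //; exact: Lfun1_indic.
Qed.

Let atoms_eq X s f t : uniq s -> X t \in s -> atoms X s f t = f (X t).
Proof.
move=> us Xs; rewrite /atoms fct_sumE (bigD1_seq (X t))//=.
rewrite indicE mem_set//= mul1r big1 ?addr0// => r rX.
by rewrite indicE memNset ?mul0r//= => e; rewrite e eqxx in rX.
Qed.

(** Point masses of total 1 force X to lie in s almost surely, so f o X may be replaced by
    [atoms]. *)
Lemma expectation_finite_support X s f : uniq s -> measurable_fun setT f ->
  \sum_(r <- s) pmf X r = 1 ->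
  'E_P[f \o X]%E = (\sum_(r <- s) f r * pmf X r)%:E.
Proof.
move=> us mf s1; rewrite -expectation_atoms.
pose A : set T := [set t | X t \in s].
have mA : measurable A.
  rewrite (_ : A = \big[setU/set0]_(r <- s) (X @^-1` [set r])).
    by apply: bigsetU_measurable.
  rewrite -bigcup_seq; apply/seteqP; split=> t /=.
    by move=> ts; exists (X t).
  by move=> [r rs /= e]; rewrite /A/= e.
have PA : P A = 1%E.
  rewrite -(expectation_indic P mA).
  (* With f = 1 the simple function is the indicator of the event, whose probability is then the sum
     of the masses. *)
  have -> : (\1_A : T -> R) = atoms X s (cst 1).
    apply/funext => t; rewrite indicE; have [ts|ts] := boolP (X t \in s).
      by rewrite atoms_eq// mem_set.
    rewrite memNset; last exact/negP.
    rewrite /atoms fct_sumE big_seq big1// => r rs /=.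
    rewrite indicE memNset ?mul0r//= => e.
    by rewrite e rs in ts.
  by rewrite expectation_atoms; under eq_bigr do rewrite mul1r; rewrite s1.
rewrite unlock; apply: ae_eq_integral => //.
- by apply/measurable_EFinP; apply: measurableT_comp.
- apply/measurable_EFinP; rewrite /atoms.
  elim/big_ind: _ => [|g h mg mh|r _]; first exact: measurable_cst.
    exact: measurable_funD.
  by apply: measurable_funM => //; exact: measurable_indic.
- exists (~` A); split.
  + exact: measurableC.
  + by apply: (etrans (probability_setC P mA)); rewrite PA subee.
  + by move=> t /=; apply: contra_not => ts _; rewrite atoms_eq.
Qed.

Lemma mgf_C_finite_support X s z : uniq s -> \sum_(r <- s) pmf X r = 1 ->
  mgf_C X z = \sum_(r <- s) (pmf X r)%:C * cexp (z * r%:C).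
Proof.
move=> us s1; rewrite /mgf_C /cexpectation.
have meas : measurable_fun setT (fun r : R => complex.Re (cexp (z * r%:C))) /\
    measurable_fun setT (fun r : R => complex.Im (cexp (z * r%:C))).
  have E r : cexp (z * r%:C) =
      (expR (complex.Re z * r) * cos (complex.Im z * r)) +i*
      (expR (complex.Re z * r) * sin (complex.Im z * r)).
    by case: (z) => x y /=; rewrite !mulr0 subr0 add0r.
  have ml (c : R) : measurable_fun setT (fun r : R => c * r).
    exact: measurable_funM.
  split; under eq_fun => r do rewrite E /=; apply: measurable_funM.
  - exact: (measurableT_comp (@measurable_expR R)).
  - apply: (@measurableT_comp _ _ _ _ _ _ (@cos R)); last exact: ml.
    by apply: continuous_measurable_fun; exact: continuous_cos.
  - exact: (measurableT_comp (@measurable_expR R)).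
  - apply: (@measurableT_comp _ _ _ _ _ _ (@sin R)); last exact: ml.
    by apply: continuous_measurable_fun; exact: continuous_sin.
have [mRe mIm] := meas.
have := expectation_finite_support us mRe s1; rewrite /comp => ->.
have := expectation_finite_support us mIm s1; rewrite /comp => -> /=.
elim: s {us s1} => [|r s IHs]; first by rewrite !big_nil.
rewrite !big_cons -IHs; case: (cexp (z * r%:C)) => x y.
by apply/eqP; rewrite eq_complex/=; apply/andP; split; apply/eqP; ring.
Qed.

(** The generating polynomial of the Stirling numbers is used twice: at c, to see that the masses
    sum to 1, and at c e^z, to sum the series. *)
Lemma mgf_C_stirling n (c : R) X z : (0 < n)%N -> 0 < c ->
  has_stirling_law n c X ->
  mgf_C X z = rising n (c%:C * cexp z) / rising n c%:C.
Proof.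
move=> n0 c0 lawX.
have rc0 : rising n c != 0.
  by rewrite gt_eqF// prodr_gt0// => i _; rewrite ltr_wpDr.
rewrite (@mgf_C_finite_support X [seq k%:R | k <- index_iota 1 n.+1]).
- rewrite big_map risingE_pos// mulr_suml !big_seq; apply: eq_bigr => k.
  rewrite mem_index_iota ltnS => kn; rewrite lawX//.
  rewrite -(rising_rmorph (real_complex R)).
  rewrite rmorphM (fmorphV (real_complex R)) rmorphM rmorphXn !rmorph_nat.
  by rewrite mulr_natr cexpMn exprMn mulrAC -!mulrA.
- by rewrite map_inj_uniq ?iota_uniq//; exact: mulrIn.
- rewrite big_map big_seq; under eq_bigr.
    move=> k; rewrite mem_index_iota ltnS => kn; rewrite lawX//; over.
  by rewrite -big_seq -mulr_suml -risingE_pos// divff.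
Qed.

End stirling_mgf.

(** * The strip |Im z| < pi/2 and bounds on its compact subsets *)

Section strip.
Context {R : realType}.
Implicit Types (theta : R) (K : set R[i]^o).

Lemma continuous_Re : continuous (fun z : R[i]^o => complex.Re z : R).
Proof.
move=> z; apply/(@cvgrPdist_lt _ _ _ _ (nbhs_filter z)) => e e0.
apply/nbhs_ballP; exists e%:C => [|y]; first by rewrite /= ltcR.
rewrite -ball_normE /ball_/= norm_normc ltcR -ReN -ReD.
exact/le_lt_trans/ge_normc_Re.
Qed.

Lemma continuous_Im : continuous (fun z : R[i]^o => complex.Im z : R).
Proof.
move=> z; apply/(@cvgrPdist_lt _ _ _ _ (nbhs_filter z)) => e e0.
apply/nbhs_ballP; exists e%:C => [|y]; first by rewrite /= ltcR.
rewrite -ball_normE /ball_/= norm_normc ltcR -ImN -ImD.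
exact/le_lt_trans/ge_normc_Im.
Qed.

Definition strip : set R[i]^o := [set z | `|complex.Im z| < pi / 2].

Lemma open_strip : open strip.
Proof.
apply: (@open_comp _ _ (fun z : R[i]^o => `|complex.Im z|) [set x | x < pi / 2]).
  move=> z _.
  apply: (@continuous_comp _ _ _ (fun z : R[i]^o => complex.Im z) Num.norm).
    exact: continuous_Im.
  exact: norm_continuous.
exact: open_lt.
Qed.

(** Re (theta e^z) = theta e^x cos y is continuous and positive on K, so its minimum yields k; the
    maximum of Re z yields B. *)
Lemma compact_strip_bounds theta K : 0 < theta -> compact K -> K `<=` strip ->
  exists k B, theta^-1 <= k /\ forall z, K z ->
    (complex.Re (theta%:C * cexp z))^-1 <= k /\ normc (limit1 theta z) <= B.
Proof.
move=> theta0 cK Kstrip.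
have [->|/set0P K0] := eqVneq K set0; first by exists theta^-1, 0; split.
have cRe : continuous (fun z : R[i]^o =>
    theta * (expR (complex.Re z) * cos (complex.Im z))).
  move=> z; have Fz := nbhs_filter z.
  have cexpR : {for z, continuous (fun z : R[i]^o => expR (complex.Re z))}.
    apply: (@continuous_comp _ _ _ (fun z : R[i]^o => complex.Re z) expR).
      exact: continuous_Re.
    exact: continuous_expR.
  have ccos : {for z, continuous (fun z : R[i]^o => cos (complex.Im z))}.
    apply: (@continuous_comp _ _ _ (fun z : R[i]^o => complex.Im z) cos).
      exact: continuous_Im.
    exact: continuous_cos.
  apply: (@cvgM _ _ _ Fz _ _ _ _ (@cvg_cst _ theta _ _ Fz)).
  exact: (@cvgM _ _ _ Fz _ _ _ _ cexpR ccos).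
have [a /set_mem Ka aP] := compact_EVT_min K0 cK (continuous_subspaceT cRe).
have [b Kb bP] := compact_EVT_max K0 cK (continuous_subspaceT continuous_Re).
have ReE (z : R[i]) : complex.Re (theta%:C * cexp z) =
    theta * (expR (complex.Re z) * cos (complex.Im z)).
  by rewrite Re_realM; case: z.
exists (Num.max theta^-1 (complex.Re (theta%:C * cexp a))^-1).
exists (expR ((complex.Re b + ln (theta + 1)) / 2)).
split=> [|z Kz]; first by rewrite le_max lexx.
split.
  rewrite le_max; apply/orP; right.
  rewrite lef_pV2 ?posrE ?Re_cexp_gt0//; [|exact: Kstrip|exact: Kstrip].
  by rewrite !ReE aP//; apply/mem_set.
apply: le_trans (normc_limit1_le theta0 (Kstrip z Kz)) _.
by rewrite ler_expR ler_pM2r// lerD2r bP//; apply/mem_set.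
Qed.

End strip.

(** * Convergence on the strip, with rate 1/n on compact sets *)

Theorem theorem2p1 (R : realType) (theta : R) (theta_gt0 : 0 < theta) :
  exists D : set R[i]^o,
    [/\ open D,
        (forall x : R, D x%:C),
        (forall z : R[i], D z ->
           slit_plane (theta%:C * cexp z) /\
           slit_plane ((theta%:C + 1) / (theta%:C * cexp z + 1)))
      & forall (d : nat -> measure_display)
               (T : forall n : nat, measurableType (d n))
               (P : forall n : nat, probability (T n) R)
               (X : forall n : nat, {RV (P n) >-> R}),
          (forall n : nat, (0 < n)%N ->
             has_stirling_law n (theta * n%:R) (X n)) ->
          let ratio (n : nat) (z : R[i]) : R[i] :=
            mgf_C (X n) z / cexp (n%:R * phi1 theta z) in
          (forall z : R[i], D z ->
             (ratio n z : R[i]^o) @[n --> \oo] --> (limit1 theta z : R[i]^o)) /\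
          (forall K : set R[i]^o, compact K -> K `<=` D ->
             exists M : R, \forall n \near \oo, forall z : R[i], K z ->
               `|ratio n z - limit1 theta z| <= (M / n%:R)%:C)].
Proof.
have slitP (z : R[i]) : 0 < complex.Re z -> slit_plane z.
  by move=> z0 [+ _]; rewrite leNgt z0.
exists strip; split.
- exact: open_strip.
- by move=> x; rewrite /strip/= normr0 divr_gt0// pi_gt0.
- move=> z zD; have w0 := Re_cexp_gt0 theta_gt0 zD.
  split; first exact: slitP.
  apply: slitP; have -> : theta%:C + 1 = (theta + 1)%:C :> R[i].
    by rewrite rmorphD rmorph1.
  (* Inversion preserves the right half-plane, so the radicand has positive real part. *)
  rewrite Re_realM mulr_gt0 ?addr_gt0//.
  have : 0 < complex.Re (theta%:C * cexp z + 1) by rewrite ReD addr_gt0.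
  case: (theta%:C * cexp z + 1) => x y /= x0.
  by rewrite divr_gt0// ltr_pwDl ?sqr_ge0// exprn_gt0.
move=> d T P X lawX ratio.
have unif : forall K : set R[i]^o, compact K -> K `<=` strip ->
    exists M : R, \forall n \near \oo, forall z : R[i], K z ->
      `|ratio n z - limit1 theta z| <= (M / n%:R)%:C.
  move=> K cK Kstrip.
  have [k [B [tk kB]]] := compact_strip_bounds theta_gt0 cK Kstrip.
  set C := 4 * expR (2 * ((3 + k) * k ^+ 2)) * (2 * ((3 + k) * k ^+ 2)).
  exists (B * C); near=> n => z Kz.
  have n0 : (0 < n)%N by near: n; exact: nbhs_infty_gt.
  have [wk zB] := kB z Kz; rewrite norm_normc lecR /ratio.
  rewrite (mgf_C_stirling z n0 _ (lawX n n0)) ?mulr_gt0 ?ltr0n//.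
  have -> : (theta * n%:R)%:C = n%:R * theta%:C :> R[i].
    by rewrite rmorphM rmorph_nat mulrC.
  rewrite -[X in rising n X / _]mulrA.
  apply: le_trans (rising_ratio_le theta_gt0 (Kstrip z Kz) n0 wk tk) _.
  rewrite ler_wpM2r// ler_wpM2r//.
  have k0 : 0 <= k by rewrite (le_trans _ tk)// invr_ge0 ltW.
  by rewrite !mulr_ge0 ?expR_ge0 ?addr_ge0.
(* Pointwise convergence is the uniform bound on the compact set {z}. *)
split=> // z zD.
have cz : compact ([set z] : set R[i]^o) by exact: compact_set1.
have [|M nearM] := unif [set z] cz; first by move=> _ ->.
(* The norm of [R[i]] is itself complex-valued, so the tolerance e is a complex number; being
   positive, it has imaginary part 0. *)
apply/cvgrPdist_le => e; rewrite ltcE => /andP[/eqP e_im e0].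
near=> n.
have n0 : (0 < n)%N by near: n; exact: nbhs_infty_gt.
have Mn : M / complex.Re e <= n%:R by near: n; exact: nbhs_infty_ger.
rewrite distrC; apply: (@le_trans _ _ (M / n%:R)%:C).
  by near: n; apply: filterS nearM => n; exact.
rewrite lecE/= e_im eqxx/= ler_pdivrMr ?ltr0n//.
by move: Mn; rewrite ler_pdivrMr// mulrC.
Unshelve. all: by end_near.
Qed.
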